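(* Let $r\ge1$ be an integer and let $A$ be the quiver of Dynkin type $\mathbb A_r$ with the linear orientation $0\leftarrow 1\leftarrow 2\leftarrow\cdots\leftarrow r-1$. Then for any $i\in[0,r-1]$ and $n\in[1,r-i]$, $$X^{A,\mathbf y}_{S_i^{(n)}}=P_n\big(y_i,\dots,y_{i+n-1},X^{A,\mathbf y}_{S_i},\dots,X^{A,\mathbf y}_{S_{i+n-1}}\big),$$ or equivalently $$X^{A,\mathbf y}_{S_i^{(n)}}=\det\begin{bmatrix} X^{A,\mathbf y}_{S_{i+n-1}} & 1 & & & (0)\\ y_{i+n-1} & \ddots & \ddots & & \\ & \ddots & \ddots & \ddots & \\ & & \ddots & \ddots & 1\\ (0) & & & y_{i+1} & X^{A,\mathbf y}_{S_i}\end{bmatrix}$$ (the $n\times n$ tridiagonal determinant with diagonal $X^{A,\mathbf y}_{S_{i+n-1}},\dots,X^{A,\mathbf y}_{S_i}$, superdiagonal entries $1$, subdiagonal $y_{i+n-1},\dots,y_{i+1}$).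
   Context: $[a,b]$ denotes an interval of integers. $k=\mathbb C$; $kA$-mod is the category of finite-dimensional left modules over the path algebra of $A$, identified with finite-dimensional representations of $A$. $S_i$ is the simple module at vertex $i$, and for $i\in[0,r-1]$, $n\in[1,r-i]$, $S_i^{(n)}$ is the (unique up to isomorphism) indecomposable $kA$-module with socle $S_i$ and length $n$. Cluster character with coefficients: for an acyclic quiver $Q$ with vertex set $Q_0$, let $\mathbf x=(x_i)_{i\in Q_0}$, $\mathbf y=(y_i)_{i\in Q_0}$ be indeterminates. Let $\underline{\dim} M\in\mathbb Z^{Q_0}$ be the dimension vector, $\alpha_i=\underline{\dim} S_i$, and $\langle M,N\rangle=\dim\mathrm{Hom}_{kQ}(M,N)-\dim\mathrm{Ext}^1_{kQ}(M,N)$ the Euler form, viewed as a bilinear form on dimension vectors. Let $\mathrm{Gr}_{\mathbf e}(M)$ be the projective variety of submodules of $M$ of dimension vector $\mathbf e$ and $\chi$ the Euler characteristic. For $M$ indecomposable, $$X^{Q,\mathbf y}_M=\sum_{\mathbf e\in\mathbb N^{Q_0}}\chi(\mathrm{Gr}_{\mathbf e}(M))\prod_{i\in Q_0}x_i^{-\langle\mathbf e,\alpha_i\rangle-\langle\alpha_i,\underline{\dim} M-\mathbf e\rangle}y_i^{e_i}\in\mathbb Z[\mathbf y][\mathbf x^{\pm1}],$$ and $X^{Q,\mathbf y}_{M\oplus N}=X^{Q,\mathbf y}_MX^{Q,\mathbf y}_N$. Here $Q=A$. Quantized Chebyshev polynomial $P_n$: let $\{q_i\}_{i\in\mathbb Z}$,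 $\{x_{i,1}\}_{i\in\mathbb Z}$ be indeterminates and define $x_{i,n}$ ($x_{i,0}=1$) by $x_{i,n}x_{i+1,n}=x_{i,n+1}x_{i+1,n-1}+\prod_{k=1}^nq_{i+k}$. Then $P_n$ is the polynomial in $2n$ variables (independent of $i$) such that $x_{i,n}=P_n(q_i,\dots,q_{i+n-1},x_{i,1},\dots,x_{i+n-1,1})$; it equals the determinant of the $n\times n$ tridiagonal matrix with diagonal $x_{i+n-1,1},\dots,x_{i,1}$, superdiagonal entries $1$ and subdiagonal $q_{i+n-1},\dots,q_{i+1}$. *)

(* Defs.v *)
From HB Require Import structures.
From mathcomp Require Import all_boot all_order all_algebra generic_quotient.
From mathcomp Require Import all_classical all_reals all_analysis.
From mathcomp Require Import complex fraction.
(* The notations of mpoly clash with those of MathComp-Analysis. *)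
From mathcomp Require Import -(notations) mpoly.
Import Order.TTheory GRing.Theory Num.Theory numFieldNormedType.Exports.

Set Implicit Arguments.
Unset Strict Implicit.
Unset Printing Implicit Defensive.

Local Open Scope classical_set_scope.
Local Open Scope quotient_scope.
Local Open Scope ring_scope.

(* For subspaces B <= Z of V: the classes of b_0, ..., b_(d-1) form a basis of
   Z / B, so that dim (Z / B) = d. *)
Definition has_quot_dim (K : fieldType) (V : lmodType K) (Z B : set V)
    (d : nat) : Prop :=
  exists b : 'I_d -> V, (forall k, Z (b k)) /\
    forall z, Z z -> exists! a : 'rV[K]_d, B (z - \sum_k a 0 k *: b k).

Section Simplices.
Variable R : realType.

Definition std_simplex (n : nat) : set 'rV[R]_n.+1 :=
  [set t | (forall i, 0 <= t 0 i) /\ \sum_i t 0 i = 1].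

(* set_type carries the subspace topology. *)
Definition Delta (n : nat) : topologicalType := set_type (@std_simplex n).

Definition face_row (n : nat) (k : 'I_n.+2) (t : 'rV[R]_n.+1) : 'rV[R]_n.+2 :=
  \row_l (if unlift k l is Some j then t 0 j else 0).

Lemma face_rowP n (k : 'I_n.+2) (t : 'rV[R]_n.+1) :
  std_simplex t -> std_simplex (face_row k t).
Proof.
case=> t0 t1; split=> [l|].
  by rewrite mxE; case: unlift => [j|].
rewrite (bigD1_ord k) //= mxE unlift_none add0r -t1.
by apply: eq_bigr => j _; rewrite mxE liftK.
Qed.

Lemma face_row_continuous n (k : 'I_n.+2) : continuous (@face_row n k).
Proof.
move=> t A [P Pn PA].
have Fn : Filter (nbhs t) by exact: nbhs_filter.
have P0 l : nbhs t [set u | P ord0 l (face_row k u ord0 l)].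
  have := Pn ord0 l; rewrite /face_row mxE.
  case E: (unlift k l) => [j|] Pl.
    have Pj : nbhs t [set u | P ord0 l (u ord0 j)].
      exact: (@coord_continuous R 1 n.+1 ord0 j t _ Pl).
    by apply: (@filterS _ (nbhs t) Fn _ _ _ Pj) => u; rewrite /= mxE E.
  have -> : [set u | P ord0 l (face_row k u ord0 l)] = setT.
    apply/seteqP; split=> // u _; rewrite /= mxE E; exact: nbhs_singleton Pl.
  exact: (@filterT _ (nbhs t) Fn).
have Pall := filter_forall Fn P0; apply: (@filterS _ (nbhs t) Fn _ _ _ Pall) => u Pu.
by apply: PA => i l; rewrite ord1; exact: Pu.
Qed.

Definition face n (k : 'I_n.+2) (t : Delta n) : Delta n.+1 :=
  exist _ (face_row k (val t)) (mem_set (face_rowP k (set_mem (valP t)))).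

Lemma face_continuous n (k : 'I_n.+2) : continuous (@face n k).
Proof.
apply: continuous_comp_initial => t.
apply: (@continuous_comp _ _ _ (set_val : Delta n -> _) (@face_row n k)).
  exact: initial_continuous.
exact: face_row_continuous.
Qed.

End Simplices.

Section EulerCharacteristic.
Variables (R : realType) (X : topologicalType).

Definition simplex (n : nat) := continuousType (Delta R n) X.

Definition cochain (n : nat) : lmodType rat := simplex n -> rat^o.

Definition simplex_face n (k : 'I_n.+2) (s : simplex n.+1) : simplex n :=
  s \o mkcts (@face_continuous R n k).

Definition coboundary n (f : cochain n) : cochain n.+1 :=
  fun s => \sum_(k < n.+2) (-1) ^+ k * f (simplex_face k s).

Definition cocycles n : set (cochain n) := [set f | coboundary f = 0].

Definition coboundaries n : set (cochain n) :=
  if n is m.+1 then range (@coboundary m) else [set 0].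

(* Dimension of the singular cohomology space H^n(X; rat). *)
Definition has_betti (n b : nat) : Prop :=
  has_quot_dim (@cocycles n) (@coboundaries n) b.

Definition has_euler_char (c : int) : Prop :=
  exists (b : nat -> nat) (N : nat),
    [/\ forall n, has_betti n (b n), forall n, (N <= n)%N -> b n = 0%N &
        c = \sum_(n < N) (-1) ^+ n * (b n)%:Z].

(* Junk value 0 when the rational cohomology is not finite dimensional. *)
Definition euler_char : int := xget 0 has_euler_char.

End EulerCharacteristic.

Record quiver := Quiver {
  vert : finType;
  arrow : finType;
  src : arrow -> vert;
  tgt : arrow -> vert }.

(* Finite-dimensional representations, with the spaces K^(d i) in place of
   abstract ones.  Vectors are row vectors: the map of the arrow a is
   v |-> v *m act a. *)
Record rep (K : fieldType) (Q : quiver) := Rep {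
  dimv : vert Q -> nat;
  act : forall a : arrow Q, 'M[K]_(dimv (src a), dimv (tgt a)) }.

Section Families.
Variables (K : fieldType) (Q : quiver) (M N : rep K Q).

Definition fam : Type := forall i : vert Q, 'M[K]_(dimv M i, dimv N i).

HB.instance Definition _ := gen_eqMixin fam.
HB.instance Definition _ := gen_choiceMixin fam.

Let fam_add (f g : fam) : fam := fun i => f i + g i.
Let fam_zero : fam := fun i => 0.
Let fam_opp (f : fam) : fam := fun i => - f i.
Let fam_scale (a : K) (f : fam) : fam := fun i => a *: f i.

Let fam_addA : associative fam_add.
Proof. by move=> f g h; apply: functional_extensionality_dep => i; apply: addrA. Qed.
Let fam_addC : commutative fam_add.
Proof. by move=> f g; apply: functional_extensionality_dep => i; apply: addrC. Qed.
Let fam_add0 : left_id fam_zero fam_add.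
Proof. by move=> f; apply: functional_extensionality_dep => i; apply: add0r. Qed.
Let fam_addN : left_inverse fam_zero fam_opp fam_add.
Proof. by move=> f; apply: functional_extensionality_dep => i; apply: addNr. Qed.

HB.instance Definition _ :=
  GRing.isZmodule.Build fam fam_addA fam_addC fam_add0 fam_addN.

Let fam_scaleA a b f : fam_scale a (fam_scale b f) = fam_scale (a * b) f.
Proof. by apply: functional_extensionality_dep => i; apply: scalerA. Qed.
Let fam_scale1 : left_id 1 fam_scale.
Proof. by move=> f; apply: functional_extensionality_dep => i; apply: scale1r. Qed.
Let fam_scaleDr : right_distributive fam_scale +%R.
Proof. by move=> a f g; apply: functional_extensionality_dep => i; apply: scalerDr. Qed.
Let fam_scaleDl f : {morph fam_scale^~ f : a b / a + b}.
Proof. by move=> a b; apply: functional_extensionality_dep => i; apply: scalerDl. Qed.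

HB.instance Definition _ :=
  GRing.Zmodule_isLmodule.Build K fam fam_scaleA fam_scale1 fam_scaleDr fam_scaleDl.

Definition hom : set fam :=
  [set f | forall a : arrow Q, act M a *m f (tgt a) = f (src a) *m act N a].

(* Row vectors: row_free is injectivity, row_full is surjectivity. *)
Definition mono (f : fam) : Prop := forall i, row_free (f i).
Definition epi (f : fam) : Prop := forall i, row_full (f i).

End Families.

Section Modules.
Variables (K : fieldType) (Q : quiver).
Implicit Types M N P L : rep K Q.

Definition famcomp M N P (f : fam M N) (g : fam N P) : fam M P :=
  fun i => f i *m g i.

Definition projective P : Prop :=
  forall M N (g : fam M N) (f : fam P N), hom g -> epi g -> hom f ->
    exists2 h : fam P M, hom h & famcomp h g = f.

Definition short_exact L P M (u : fam L P) (p : fam P M) : Prop :=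
  [/\ hom u, hom p, mono u, epi p & forall i, (u i :=: kermx (p i))%MS].

Definition hom_dim M N : nat :=
  xget 0%N (has_quot_dim (@hom K Q M N) [set 0]).

(* Ext^1(M, N) = coker (Hom(P, N) -> Hom(L, N)) for a short exact sequence
   0 -> L -> P -> M -> 0 with P projective; its dimension does not depend on
   the sequence.  Such a sequence of finite-dimensional representations exists
   when Q is acyclic. *)
Definition ext1_dim M N : nat :=
  xget 0%N [set d | exists L P (u : fam L P) (p : fam P M),
    [/\ projective P, short_exact u p &
        has_quot_dim (@hom K Q L N)
          [set f | exists2 g : fam P N, hom g & f = famcomp u g] d]].

Definition simple_rep (i : vert Q) : rep K Q :=
  @Rep K Q (fun j => (j == i) : nat) (fun _ => 0).

Definition dimvz M (i : vert Q) : int := (dimv M i)%:Z.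

(* The Euler form on dimension vectors: the bilinear form on Z^(vert Q) whose
   values on the basis of dimension vectors of simples are
   dim Hom(S_i, S_j) - dim Ext^1(S_i, S_j). *)
Definition euler_form (d e : vert Q -> int) : int :=
  \sum_i \sum_j d i * e j *
    ((hom_dim (simple_rep i) (simple_rep j))%:Z -
     (ext1_dim (simple_rep i) (simple_rep j))%:Z).

(* A family of subspaces, the i-th one being the row space of U i. *)
Definition subfam M : Type := forall i : vert Q, 'M[K]_(dimv M i).

Definition submod M (U : subfam M) : Prop :=
  forall a : arrow Q, (U (src a) *m act M a <= U (tgt a))%MS.

Definition sub_le M (U V : subfam M) : Prop := forall i, (U i <= V i)%MS.

Definition sub0 M : subfam M := fun i => 0.
Definition sub1 M : subfam M := fun i => 1%:M.

(* U < V are submodules such that V / U is simple. *)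
Definition sub_covers M (U V : subfam M) : Prop :=
  [/\ submod U, submod V, sub_le U V, ~ sub_le V U &
      forall W, submod W -> sub_le U W -> sub_le W V ->
        sub_le W U \/ sub_le V W].

Definition has_length M (n : nat) : Prop :=
  exists U : nat -> subfam M,
    [/\ U 0%N = sub0 M, U n = sub1 M &
        forall k, (k < n)%N -> sub_covers (U k) (U k.+1)].

(* U is the sum of all simple submodules of M. *)
Definition is_socle M (U : subfam M) : Prop :=
  [/\ submod U,
      forall V, sub_covers (sub0 M) V -> sub_le V U &
      forall W, submod W ->
        (forall V, sub_covers (sub0 M) V -> sub_le V W) -> sub_le U W].

Definition indecomposable M : Prop :=
  ~ sub_le (sub1 M) (sub0 M) /\
  forall U V : subfam M, submod U -> submod V ->
    (forall i, (U i + V i :=: 1%:M)%MS) -> (forall i, (U i :&: V i)%MS = 0) ->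
    sub_le U (sub0 M) \/ sub_le V (sub0 M).

Definition socle_simple M (i : vert Q) : Prop :=
  exists f : fam (simple_rep i) M,
    [/\ hom f, mono f & is_socle ((fun j => <<f j>>%MS) : subfam M)].

(* The defining properties of S_i^(n). *)
Definition is_serial M (i : vert Q) (n : nat) : Prop :=
  [/\ indecomposable M, socle_simple M i & has_length M n].

End Modules.

(* The field of complex numbers, for a model R of the reals. *)
Definition Cplx (R : realType) : numClosedFieldType := complex R.

Section Grassmannian.
Variables (R : realType) (Q : quiver).
Variables (M : rep (Cplx R) Q) (e : {ffun vert Q -> nat}).

(* Families (A_i) of e_i linearly independent vectors of M_i that span a
   submodule of M, topologized as a subspace of a product of matrix spaces. *)
Definition frames :
    set (prod_topology (fun i : vert Q => 'M[Cplx R]_(e i, dimv M i))) :=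
  [set A | (forall i, row_free (A i)) /\
           forall a : arrow Q, (A (src a) *m act M a <= A (tgt a))%MS].

Definition same_span : rel (set_type frames) :=
  [rel A B | [forall i, (val A i == val B i)%MS]].

Lemma same_span_equiv : equiv_class_of same_span.
Proof.
split.
- by move=> A; apply/forallP => i; rewrite submx_refl.
- by move=> A B; apply/forallP/forallP => h i; rewrite andbC h.
- move=> B A C /forallP AB /forallP BC; apply/forallP => i.
  have /andP[AB1 AB2] := AB i; have /andP[BC1 BC2] := BC i.
  by rewrite (submx_trans AB1 BC1) (submx_trans BC2 AB2).
Qed.

Canonical same_span_equiv_rel := EquivRelPack same_span_equiv.

(* The submodules of M of dimension vector e, with the analytic topology of
   the quiver Grassmannian: the quotient of the space of frames by the base
   changes in prod_i GL_(e_i). *)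
Definition Gr : topologicalType :=
  quotient_topology {eq_quot same_span_equiv_rel}.

End Grassmannian.

(* X_M^(Q,y) for indecomposable M, with values in a field F containing the
   x_i and y_i; nonindecomposable modules, for which X is extended by
   X_(M + N) = X_M X_N, are not needed. *)
Definition cluster_char (R : realType) (Q : quiver) (F : fieldType)
    (x y : vert Q -> F) (M : rep (Cplx R) Q) : F :=
  \sum_(e \in [set: {ffun vert Q -> nat}])
    (euler_char R (Gr M e))%:~R *
    \prod_i
      (x i ^ (- euler_form (Cplx R) (fun j => (e j)%:Z)
                 (dimvz (simple_rep (Cplx R) i))
              - euler_form (Cplx R) (dimvz (simple_rep (Cplx R) i))
                 (fun j => dimvz M j - (e j)%:Z))
       * y i ^+ e i).

Definition indet (N : nat) (k : 'I_N) : {fraction mpoly N int} :=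
  tofrac (mpolyX int (mnm1 k)).

(* x_(i,n), from q_j and x_(j,1) = x j, by
   x_(i,n) x_(i+1,n) = x_(i,n+1) x_(i+1,n-1) + prod_(1 <= k <= n) q_(i+k). *)
Fixpoint cheb_frac (F : fieldType) (q x : nat -> F) (n i : nat) : F :=
  match n with
  | 0 => 1
  | m.+1 =>
    match m with
    | 0 => x i
    | p.+1 => (cheb_frac q x m i * cheb_frac q x m i.+1
               - \prod_(1 <= k < m.+1) q (i + k)%N) / cheb_frac q x p i.+1
    end
  end.

(* P_n, in the variables q_0, ..., q_(n-1), x_(0,1), ..., x_(n-1,1) in this
   order: the polynomial equal to x_(0,n).  The latter involves no q_j nor
   x_(j,1) with n <= j, which are set to 0. *)
Definition cheb_poly (n : nat) : mpoly (n + n) int :=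
  let q j := oapp (fun k : 'I_n => indet (lshift n k)) 0 (insub j) in
  let x j := oapp (fun k : 'I_n => indet (rshift n k)) 0 (insub j) in
  xget 0 [set p | tofrac p = cheb_frac q x n 0].

Definition cheb_eval (F : fieldType) (n : nat) (u v : 'I_n -> F) : F :=
  mmap intr (fun k : 'I_(n + n) =>
    match fintype.split k with inl l => u l | inr l => v l end) (cheb_poly n).

Definition linear_quiver (r : nat) : quiver :=
  @Quiver 'I_r {p : 'I_r * 'I_r | p.1 == p.2.+1 :> nat}
    (fun p => (val p).1) (fun p => (val p).2).

Definition xvar (r : nat) (i : 'I_r) : {fraction mpoly (r + r) int} :=
  indet (lshift r i).

Definition yvar (r : nat) (i : 'I_r) : {fraction mpoly (r + r) int} :=
  indet (rshift r i).

Lemma ord_add_proof (r : nat) (i : 'I_r) (n : nat) (le_n : (n <= r - i)%N)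
  (k : 'I_n) : (i + k < r)%N.
Proof. by rewrite -ltn_subRL; apply: leq_trans (ltn_ord k) le_n. Qed.

Definition ord_add (r : nat) (i : 'I_r) (n : nat) (le_n : (n <= r - i)%N)
  (k : 'I_n) : 'I_r := Ordinal (ord_add_proof le_n k).

(* Diagonal v_(n-1), ..., v_0, superdiagonal 1, subdiagonal
   u_(n-1), ..., u_1. *)
Definition tridiag (F : fieldType) (n : nat) (u v : 'I_n -> F) : 'M[F]_n :=
  \matrix_(k, l)
    if k == l then v (rev_ord k)
    else if l == k.+1 :> nat then 1
    else if k == l.+1 :> nat then u (rev_ord l)
    else 0.

(* Main.v *)
From HB Require Import structures.
From mathcomp Require Import all_boot all_order all_algebra generic_quotient.
From mathcomp Require Import all_classical all_reals all_analysis.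
From mathcomp Require Import complex fraction.
From mathcomp Require Import -(notations) mpoly.
From mathcomp Require Import ring zify.
Require Import Defs.

(** The modules in question are so small that both sides can be computed.

    A module with simple socle S_i over the linear quiver is thin: a vector of
    M_j that every arrow kills spans a simple submodule, so all arrows act
    injectively except the one leaving i, where M_i is one dimensional
    ([killed_socle], [act_free_off_socle]).  Hence M is K on an interval
    starting at i, a submodule is determined by the length k of its own
    interval, and a module of length n has the n + 1 submodules of lengths
    k = 0, ..., n ([serial_dimv], [submodule_profile]).  Every Grassmannian of
    M is therefore a point or empty, with Euler characteristic 1 or 0
    ([euler_char_Gr_interval], [euler_char_Gr_other]).

    The Euler form only needs Hom and Ext^1 between simple modules.  For Ext^1,
    a homomorphism L -> S_j in a projective resolution 0 -> L -> P -> S_i -> 0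
    is sent to the cocycle that it defines on the arrows ([ext_class]); this
    identifies the cokernel of Hom(P, S_j) -> Hom(L, S_j) with the space of
    functions on the arrows from i to j, whatever the resolution is.  With
    x_(-1) = x_r = 1, this gives the formula ([cluster_char_interval])

      X_M = sum_(k <= n) x_(i-1) x_(i+n) / (x_(i+k-1) x_(i+k))
              * y_i ... y_(i+k-1).

    Up to the factor x_(i+n), increasing n only adds a term to this sum, which
    yields the recurrence
    X_(n+2) = X_(S_(i+n+1)) X_(n+1) - y_(i+n+1) X_n ([serial_charS]), which is
    the expansion of the tridiagonal determinant along its first row
    ([det_tridiag]).  The same recurrence, called [continuant] below, solves
    the defining relation of the Chebyshev polynomials
    ([continuant_frieze]); the divisions in that relation are legitimate
    because a generic continuant specializes to 1, hence is not zero
    ([cheb_polyE]). *)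

Import Order.TTheory GRing.Theory Num.Theory.

Set Implicit Arguments.
Unset Strict Implicit.
Unset Printing Implicit Defensive.

Local Open Scope classical_set_scope.
Local Open Scope quotient_scope.
Local Open Scope ring_scope.

(** * Dimensions of subquotients *)

Definition subspace (K : fieldType) (V : lmodType K) (B : set V) : Prop :=
  [/\ B 0, forall u v, B u -> B v -> B (u + v) & forall a u, B u -> B (a *: u)].

Lemma subspace_sum (K : fieldType) (V : lmodType K) (B : set V) (I : finType)
    (a : I -> K) (u : I -> V) :
  subspace B -> (forall k, B (u k)) -> B (\sum_k a k *: u k).
Proof.
by case=> B0 BD BZ Bu; apply: big_ind => // k _; apply: BZ.
Qed.

(** Each of two families of representatives is a combination of the other
    modulo B; by uniqueness of coordinates the two matrices of coefficients are
    inverse to each other. *)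
Lemma has_quot_dim_uniq (K : fieldType) (V : lmodType K) (Z B : set V) (d d' : nat) :
  subspace B -> has_quot_dim Z B d -> has_quot_dim Z B d' -> d = d'.
Proof.
move=> sB [b [Zb hb]] [b' [Zb' hb']]; have [B0 BD BZ] := sB.
have /choice[P hP] : forall k, exists a : 'rV[K]_d', B (b k - \sum_l a 0 l *: b' l).
  by move=> k; have [a [? _]] := hb' _ (Zb k); exists a.
have /choice[Q hQ] : forall k, exists a : 'rV[K]_d, B (b' k - \sum_l a 0 l *: b l).
  by move=> k; have [a [? _]] := hb _ (Zb' k); exists a.
(* Used in both directions: rewriting c through c' and back is the identity. *)
have key m m' (c : 'I_m -> V) (c' : 'I_m' -> V) (S : 'I_m -> 'rV[K]_m') (T : 'I_m' -> 'rV[K]_m) :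
    (forall k, Z (c k)) ->
    (forall z, Z z -> exists! a : 'rV[K]_m, B (z - \sum_k a 0 k *: c k)) ->
    (forall k, B (c k - \sum_l S k 0 l *: c' l)) ->
    (forall k, B (c' k - \sum_l T k 0 l *: c l)) ->
    (\matrix_k S k) *m (\matrix_k T k) = 1%:M.
  move=> Zc hc hS hT; apply/row_matrixP => k.
  have [a [_ ua]] := hc _ (Zc k).
  rewrite -(ua (row k 1%:M)); last first.
    rewrite (bigD1 k) //= !mxE eqxx scale1r big1 ?addr0 ?subrr // => l.
    by rewrite !mxE eq_sym => /negPf ->; rewrite scale0r.
  symmetry; apply: ua; set X := (X in B X).
  suff -> : X = (c k - \sum_l S k 0 l *: c' l) +
                \sum_l S k 0 l *: (c' l - \sum_j T l 0 j *: c j).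
    by apply: (BD); [exact: hS | apply: subspace_sum].
  rewrite /X; have -> : \sum_l S k 0 l *: (c' l - \sum_j T l 0 j *: c j) =
     \sum_l S k 0 l *: c' l - \sum_l \sum_j (S k 0 l * T l 0 j) *: c j.
    rewrite -sumrB; apply: eq_bigr => l _; rewrite scalerBr scaler_sumr.
    by congr (_ - _); apply: eq_bigr => j _; rewrite scalerA.
  rewrite addrA subrK exchange_big /=; congr (_ - _); apply: eq_bigr => j _.
  rewrite -scaler_suml; congr (_ *: _); rewrite !mxE.
  by apply: eq_bigr => l _; rewrite !mxE.
have PQ := key _ _ b b' P Q Zb hb hP hQ.
have QP := key _ _ b' b Q P Zb' hb' hQ hP.
have := mulmx1_min PQ; have := mulmx1_min QP; lia.
Qed.

Lemma xget_quot_dim (K : fieldType) (V : lmodType K) (Z B : set V) (d : nat) :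
  subspace B -> has_quot_dim Z B d -> xget 0%N (has_quot_dim Z B) = d.
Proof.
by move=> sB hd; apply: xget_unique => // d' hd'; exact: has_quot_dim_uniq hd' hd.
Qed.

Lemma subspace0 (K : fieldType) (V : lmodType K) : subspace [set (0 : V)].
Proof.
by split=> // [u v -> ->|a u ->]; rewrite ?addr0 ?scaler0.
Qed.

Lemma has_quot_dim0 (K : fieldType) (V : lmodType K) (Z B : set V) :
  Z `<=` B -> has_quot_dim Z B 0.
Proof.
move=> ZB; exists (fun=> 0); split=> [[]//|z /ZB Bz]; exists 0; split.
  by rewrite /= big_ord0 subr0.
by move=> a _; apply/rowP => -[].
Qed.

(** The equivalence checks existence and uniqueness of the coordinate along b
    at once. *)
Lemma has_quot_dim1 (K : fieldType) (V : lmodType K) (Z B : set V) (b : V) :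
  Z b -> (forall z, Z z -> exists c, forall a, B (z - a *: b) <-> a = c) ->
  has_quot_dim Z B 1.
Proof.
move=> Zb h; exists (fun=> b); split=> // z /h [c hc]; exists (const_mx c); split.
  by rewrite /= big_ord1; apply/hc; rewrite mxE.
by move=> a; rewrite /= big_ord1 => /hc ac; apply/rowP => k; rewrite ord1 mxE ac.
Qed.

(** * Euler characteristics of a point and of the empty space *)

Section EulerChar.
Variables (R : realType) (X : topologicalType).

Lemma coboundary_is_linear n : linear (@coboundary R X n).
Proof.
move=> a f g; apply/funext => s; rewrite /coboundary.
have -> : (a *: (fun t => \sum_(k < n.+2) (-1) ^+ k * f (simplex_face k t))
    + (fun t => \sum_(k < n.+2) (-1) ^+ k * g (simplex_face k t)) : cochain R X n.+1) s
  = a * (\sum_(k < n.+2) (-1) ^+ k * f (simplex_face k s))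
    + \sum_(k < n.+2) (-1) ^+ k * g (simplex_face k s) by [].
rewrite mulr_sumr -big_split; apply: eq_bigr => k _ /=.
have -> : (a *: f + g : cochain R X n) (simplex_face k s)
  = a * f (simplex_face k s) + g (simplex_face k s) by [].
by ring.
Qed.

HB.instance Definition _ n := GRing.isLinear.Build rat (cochain R X n)
  (cochain R X n.+1) _ (@coboundary R X n) (@coboundary_is_linear n).

Lemma subspace_coboundaries n : subspace (@coboundaries R X n).
Proof.
case: n => [|n]; first exact: subspace0.
split=> /=.
- by exists 0 => //; rewrite linear0.
- move=> _ _ [f _ <-] [g _ <-]; exists (f + g) => //.
  by rewrite linearD.
- move=> a _ [f _ <-]; exists (a *: f) => //.
  by rewrite linearZ.
Qed.

(** Betti numbers are unique because coboundaries form a subspace, so the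
    value does not depend on the chosen witnesses. *)
Lemma euler_charE (b : nat -> nat) (N : nat) :
  (forall n, has_betti R X n (b n)) -> (forall n, (N <= n)%N -> b n = 0%N) ->
  euler_char R X = \sum_(n < N) (-1) ^+ n * (b n)%:Z.
Proof.
move=> hb hN; apply: xget_unique; first by exists b, N; split.
move=> c [b' [N' [hb' hN' ->]]].
have bb' n : b' n = b n by apply: has_quot_dim_uniq (hb' n) (hb n); exact: subspace_coboundaries.
(* Beyond the last nonzero Betti number the partial sums are constant. *)
have ext m m' : (m <= m')%N -> (forall n, (m <= n)%N -> b n = 0%N) ->
    \sum_(n < m') (-1) ^+ n * (b n)%:Z = \sum_(n < m) (-1) ^+ n * (b n)%:Z.
  move=> mm' hm; rewrite -!(big_mkord xpredT (fun n => (-1) ^+ n * (b n)%:Z)).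
  rewrite (big_cat_nat _ mm') //= [X in _ + X]big1_seq ?addr0 // => n.
  by rewrite mem_index_iota => /andP[_ /andP[/hm ->]]; rewrite mulr0.
under eq_bigr do rewrite bb'.
have [le|/ltnW le] := leqP N N'; first exact: ext.
by apply/esym/ext => // n /hN'; rewrite bb'.
Qed.

Lemma Delta_inhabited n : Delta R n.
Proof.
suff h : std_simplex (delta_mx 0 0 : 'rV[R]_n.+1) by exists (delta_mx 0 0); exact/mem_set.
split=> [i|]; first by rewrite mxE; case: (_ && _).
rewrite (bigD1 ord0) //= mxE eqxx big1 ?addr0 // => i /negPf.
by rewrite mxE eqxx => ->.
Qed.

Lemma euler_char_empty : (X -> False) -> euler_char R X = 0.
Proof.
move=> X0; rewrite (@euler_charE (fun=> 0%N) 0) ?big_ord0 // => n.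
apply: has_quot_dim0 => f _; have [B0 _ _] := @subspace_coboundaries n.
suff -> : f = 0 by exact: B0.
by apply/funext => s; case: (X0 (s (Delta_inhabited n))).
Qed.

(** A point has one simplex s in each degree, and its n + 2 faces are equal, so
    the coboundary from degree n is the alternating sum of n + 2 equal terms: 0
    when n is even, the identity when n is odd. *)
Lemma euler_char_point (x0 : X) : (forall x, x = x0) -> euler_char R X = 1.
Proof.
move=> Xx0.
have simplex_eq n (s t : simplex R X n) : s = t.
  by apply/continuousEP => ?; rewrite (Xx0 (s _)) (Xx0 (t _)).
have cb n (f : cochain R X n) s t : coboundary f s = (odd n)%:R * f t.
  rewrite /coboundary.
  under eq_bigr do rewrite (simplex_eq _ (simplex_face _ _) t).
  rewrite -mulr_suml; congr (_ * _); elim: n {f s t} => [|n IH].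
    by rewrite !big_ord_recl big_ord0 /= expr0 expr1 addr0 subrr.
  by rewrite big_ord_recr /= IH -signr_odd /=; case: (odd n); rewrite /= ?expr0 ?expr1; ring.
rewrite (@euler_charE (fun n => (n == 0%N) : nat) 1) ?big_ord1 //; last by case.
move=> n; have s0 : simplex R X n by exact: mkcts (@cst_continuous _ _ x0).
case: n s0 => [|n] s0.
  apply: (@has_quot_dim1 _ _ _ _ (fun=> 1)).
    by apply/funext => s; rewrite (cb _ _ _ s0) mul0r.
  move=> z _; exists (z s0) => a; split=> [|->].
    move=> /(congr1 (fun f : cochain R X 0 => f s0)).
    by move=> /eqP; rewrite subr_eq0 => /eqP; rewrite /= => ->; exact: esym (mulr1 a).
  by apply/funext => s; rewrite (simplex_eq _ s s0); apply/eqP; rewrite subr_eq0; apply/eqP; exact: esym (mulr1 _).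
apply: has_quot_dim0 => f f0; case: (boolP (odd n)) => on.
  exists (fun=> f s0) => //; apply/funext => s.
  by rewrite (cb _ _ _ (simplex_face ord0 s0)) on mul1r (simplex_eq _ s s0).
suff -> : f = 0 by have [] := @subspace_coboundaries n.+1.
apply/funext => s; have s1 : simplex R X n.+2 by exact: mkcts (@cst_continuous _ _ x0).
by move/(congr1 (fun g : cochain R X n.+2 => g s1)): f0; rewrite (cb _ _ _ s) /= on mul1r.
Qed.
End EulerChar.

(** * Matrices with at most one row and one column *)

Section BoolMatrices.
Variables (K : fieldType).

Lemma mul_const_mx1 (m n p : nat) :
  (const_mx 1 : 'M[K]_(m, n)) *m (const_mx 1 : 'M[K]_(n, p)) = n%:R *: const_mx 1.
Proof.
apply/matrixP => k l; rewrite !mxE mulr1.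
by under eq_bigr do rewrite !mxE mulr1; rewrite sumr_const card_ord.
Qed.

Definition entry_sum (m n : nat) (A : 'M[K]_(m, n)) : K := \sum_k \sum_l A k l.

(** The components of homomorphisms between simple modules have this shape; the
    total [entry_sum] names their only possible entry without a case
    distinction on the size. *)
Lemma bool_mx_scale (b c : bool) (A : 'M[K]_(b, c)) :
  A = entry_sum A *: const_mx 1.
Proof.
rewrite /entry_sum; case: b c A => [] [] A; apply/matrixP => -[[|k] // hk] -[[|l] // hl].
by rewrite !big_ord1 !mxE mulr1; congr (A _ _); apply: val_inj.
Qed.

Lemma bool_mx_scale_inj (b c : bool) (x y : K) : b -> c ->
  x *: (const_mx 1 : 'M[K]_(b, c)) = y *: const_mx 1 -> x = y.
Proof. by case: b c => [] [] // _ _ /matrixP/(_ 0 0); rewrite !mxE !mulr1. Qed.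

Lemma bool_mx0 (b c : bool) (A : 'M[K]_(b, c)) : ~~ (b && c) -> A = 0.
Proof. by case: b c A => [] [] // A _; rewrite ?flatmx0 ?thinmx0. Qed.

Lemma mx_no_row (m n : nat) (A B : 'M[K]_(m, n)) : m = 0%N -> A = B.
Proof. by move=> m0; apply/matrixP => -[k hk]; exfalso; rewrite m0 in hk. Qed.

Lemma mx_no_col (m n : nat) (A B : 'M[K]_(m, n)) : n = 0%N -> A = B.
Proof. by move=> n0; apply/matrixP => x [k hk]; exfalso; rewrite n0 in hk. Qed.

Lemma const_mx1_id (b : bool) : const_mx 1 = 1%:M :> 'M[K]_b.
Proof.
by case: b; apply/matrixP => -[[|x] // hx] -[[|y] // hy]; rewrite !mxE.
Qed.

Lemma const_mx1_1 : const_mx 1 = 1%:M :> 'M[K]_1.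
Proof. exact: const_mx1_id true. Qed.

End BoolMatrices.

(** * Homomorphisms between simple modules *)

Section HomSpaces.
Variables (K : fieldType) (Q : quiver).
Implicit Types M N P L : rep K Q.

Lemma famP M N (f g : fam M N) : (forall i, f i = g i) -> f = g.
Proof. by move=> h; apply: functional_extensionality_dep. Qed.

Lemma famD M N (f g : fam M N) i : (f + g) i = f i + g i. Proof. by []. Qed.
Lemma famZ M N a (f : fam M N) i : (a *: f) i = a *: f i. Proof. by []. Qed.
Lemma famB M N (f g : fam M N) i : (f - g) i = f i - g i. Proof. by []. Qed.

Lemma subspace_hom M N : subspace (@hom K Q M N).
Proof.
split=> [|f g hf hg|x f hf] a.
- by rewrite mulmx0 mul0mx.
- by rewrite !famD mulmxDr mulmxDl hf hg.
- by rewrite !famZ -scalemxAr -scalemxAl hf.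
Qed.

Lemma subspace_precomp L P N (u : fam L P) :
  subspace [set f : fam L N | exists2 g : fam P N, hom g & f = famcomp u g].
Proof.
have [h0 hD hZ] := subspace_hom P N; split=> /=.
- by exists 0 => //; apply: famP => i; rewrite /famcomp mulmx0.
- move=> _ _ [g hg ->] [g' hg' ->]; exists (g + g'); first exact: hD.
  by apply: famP => i; rewrite /famcomp mulmxDr.
- move=> a _ [g hg ->]; exists (a *: g); first exact: hZ.
  by apply: famP => i; rewrite /famcomp -scalemxAr.
Qed.

Lemma hom_dim_simple (i j : vert Q) :
  hom_dim (simple_rep K i) (simple_rep K j) = (i == j).
Proof.
apply: xget_quot_dim; first exact: subspace0.
have [->|ij] := eqVneq i j.
  apply: (@has_quot_dim1 _ _ _ _ ((fun k => const_mx 1) : fam (simple_rep K j) (simple_rep K j))).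
    by move=> a; rewrite /= mulmx0 mul0mx.
  move=> z hz; exists (entry_sum (z j)) => x; split=> [/eqP|->].
    rewrite subr_eq0 => /eqP/(congr1 (fun f : fam _ _ => f j)); rewrite famZ.
    by rewrite {1}[z j]bool_mx_scale => /bool_mx_scale_inj->.
  apply/eqP; rewrite subr_eq0; apply/eqP/famP => k; rewrite famZ.
  have [->|kj] := eqVneq k j; first exact: bool_mx_scale.
  by rewrite [LHS]bool_mx0 1?[RHS]bool_mx0 //= (negPf kj).
apply: has_quot_dim0 => f _; apply: famP => k; rewrite [f k]bool_mx0 //=.
by apply: contra ij => /andP[/eqP <- /eqP <-].
Qed.

End HomSpaces.

(** * Extensions between simple modules *)

(** Here 0 -> L -> P -> M -> 0 is a projective resolution and M, N are
    semisimple.  Vertex by vertex, [s] splits p and [ret] is the retraction of u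
    that vanishes on the image of [s]; they commute with the arrows only up to
    the class of the extension. *)
Section Ext.
Variables (K : fieldType) (Q : quiver) (M N L P : rep K Q).
Variables (u : fam L P) (p : fam P M).
Hypothesis (actM0 : forall a, act M a = 0) (actN0 : forall a, act N a = 0).
Hypothesis (projP : projective P) (ex : short_exact u p).

Let s i := pinvmx (p i).
Let ret i := (1%:M - p i *m s i) *m pinvmx (u i).

Let sp i : s i *m p i = 1%:M.
Proof. by case: ex => _ _ _ ep _; apply: mulVpmx. Qed.

Let up i : u i *m p i = 0.
Proof. by case: ex => _ _ _ _ e; apply/sub_kermxP; rewrite -e. Qed.

Let retu i : ret i *m u i = 1%:M - p i *m s i.
Proof.
case: ex => _ _ _ _ e; rewrite /ret mulmxKpV // e.
by apply/sub_kermxP; rewrite mulmxBl mul1mx -mulmxA sp mulmx1 subrr.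
Qed.

Let uret i : u i *m ret i = 1%:M.
Proof.
case: ex => _ _ mu _ _.
by rewrite /ret mulmxA mulmxBr mulmx1 (mulmxA _ (p i)) up mul0mx subr0 mulmxVp.
Qed.

(** The cocycle of the push-out of the resolution along f: it measures how far
    the splitting [s] is from being a homomorphism. *)
Definition ext_class (f : fam L N) (a : arrow Q) : 'M[K]_(dimv M (src a), dimv N (tgt a)) :=
  s (src a) *m act P a *m ret (tgt a) *m f (tgt a).

(** As M is semisimple, [s] followed by an arrow of P lands in L, where [ret]
    undoes u. *)
Lemma ext_class_lift (h : fam P N) a :
  s (src a) *m act P a *m ret (tgt a) *m (u (tgt a) *m h (tgt a)) = s (src a) *m act P a *m h (tgt a).
Proof.
case: ex => _ hp _ _ _; rewrite mulmxA -(mulmxA _ (ret _)) retu mulmxBr mulmx1.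
by rewrite (mulmxA _ (p _)) -(mulmxA _ (act P a)) hp actM0 !mulmx0 mul0mx subr0.
Qed.

(** A homomorphism on P has a coboundary as its class, and coboundaries vanish
    as all arrows act by 0 on M and N.  Conversely, when the class of f is 0,
    extending f by 0 on the image of [s] gives a homomorphism on P. *)
Lemma ext_class_eq0 (f : fam L N) : hom f ->
  (forall a, ext_class f a = 0) <-> exists2 g : fam P N, hom g & f = famcomp u g.
Proof.
case: ex => hu hp _ _ _ hf; split=> [f0|[g hg ->] a]; last first.
  by rewrite /ext_class /famcomp ext_class_lift -mulmxA hg actN0 !mulmx0.
exists (fun i => ret i *m f i); last first.
  by apply: famP => i; rewrite /famcomp mulmxA uret mul1mx.
move=> a; rewrite actN0 mulmx0 -[LHS]mul1mx.
have -> : 1%:M = p (src a) *m s (src a) + ret (src a) *m u (src a) by rewrite retu addrC subrK.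
rewrite mulmxDl -(mulmxA (p _)) (mulmxA (s _)) (mulmxA (s _ *m _)).
rewrite [X in p _ *m X]f0 mulmx0 add0r -(mulmxA (ret _)) (mulmxA (u _)) -hu.
by rewrite -(mulmxA (act L a)) (mulmxA (u (tgt a)) (ret _)) uret mul1mx hf actN0 !mulmx0.
Qed.

(** The cocycle z twists the action on the direct sum of N and M into an
    extension E of M by N.  Lifting p to E, which P allows as it is projective,
    and restricting to L gives f. *)
Lemma ext_class_surj (z : forall a, 'M[K]_(dimv M (src a), dimv N (tgt a))) :
  exists2 f : fam L N, hom f & forall a, ext_class f a = z a.
Proof.
case: ex => hu hp _ ep _.
pose E := @Rep K Q (fun i => (dimv N i + dimv M i)%N)
  (fun a => block_mx (act N a) 0 (z a) (act M a)).
pose q : fam E M := fun i => col_mx 0 1%:M.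
pose k i : 'M[K]_(dimv E i, dimv N i) := col_mx 1%:M 0.
have hq : hom q.
  by move=> a; rewrite /= [LHS]mul_block_col [RHS]mul_col_mx !mulmx0 !mul0mx mulmx1 mul1mx !add0r.
have eq : epi q.
  move=> i; apply/row_fullP; exists (row_mx 0 1%:M).
  by rewrite mul_row_col mulmx0 mulmx1 add0r.
have [h hh hpq] := projP hq eq hp.
have hqE i : h i *m q i = p i by rewrite -hpq.
have hk a : act E a *m k (tgt a) = col_mx 0 (z a).
  by rewrite /= mul_block_col !mulmx0 !mulmx1 !addr0 actN0.
(* k and q are the two projections of E, so they recover the coordinates. *)
have split_row m i (A : 'M[K]_(m, dimv E i)) : A = row_mx (A *m k i) (A *m q i).
  by rewrite -[A]hsubmxK !mul_row_col !mulmx0 !mulmx1 addr0 add0r.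
exists (fun i => u i *m (h i *m k i)) => a.
  rewrite actN0 mulmx0 mulmxA hu -mulmxA (mulmxA (act P a)) hh -mulmxA hk.
  rewrite mulmxA [_ *m h _](split_row) mul_row_col mulmx0 add0r.
  have uhq : u (src a) *m h (src a) *m q (src a) = 0 by rewrite -mulmxA hqE up.
  by rewrite [X in X *m _]uhq mul0mx.
rewrite /ext_class (ext_class_lift (fun i => h i *m k i)).
rewrite -mulmxA (mulmxA (act P a)) hh -mulmxA hk mulmxA.
have shq : s (src a) *m h (src a) *m q (src a) = 1%:M by rewrite -mulmxA hqE sp.
by rewrite [_ *m h _]split_row mul_row_col mulmx0 add0r [X in X *m _]shq mul1mx.
Qed.

End Ext.

(** Being independent of the resolution, this makes the choice of a resolution
    in the definition of Ext^1 harmless. *)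
Lemma ext_quot_dim_simple (K : fieldType) (Q : quiver) (i j : vert Q) (L P : rep K Q)
    (u : fam L P) (p : fam P (simple_rep K i)) :
  (forall a b : arrow Q, src a = i -> tgt a = j -> src b = i -> tgt b = j -> a = b) ->
  projective P -> short_exact u p ->
  has_quot_dim (@hom K Q L (simple_rep K j))
    [set f | exists2 g : fam P (simple_rep K j), hom g & f = famcomp u g]
    [exists a, (src a == i) && (tgt a == j)].
Proof.
move=> arr1 projP ex; set M := simple_rep K i; set N := simple_rep K j.
have cE f : hom f -> (forall a, ext_class u p f a = 0) <->
    [set f | exists2 g : fam P N, hom g & f = famcomp u g] f.
  by move=> hf; exact: ext_class_eq0.
have [h0 hD hZ] := subspace_hom L N.
case: (boolP [exists a, _]) => [/existsP[a0 /andP[/eqP s0 /eqP t0]]|/existsPn na]; last first.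
  by apply: has_quot_dim0 => f hf; apply/cE => // a; apply: bool_mx0; exact: na.
have [f0 hf0 cf0] := ext_class_surj (M := M) (N := N) (fun a => erefl) (fun a => erefl) projP ex
   (fun a => const_mx 1).
apply: (@has_quot_dim1 _ _ _ _ f0) => // z hz.
exists (entry_sum (ext_class u p z a0)) => x.
have hzx : hom (z - x *: f0) by apply: hD => //; rewrite -scaleNr; apply: hZ.
have cB a : ext_class u p (z - x *: f0) a = ext_class u p z a - x *: const_mx 1.
  by rewrite -cf0 /ext_class famB famZ mulmxBr -scalemxAr.
split=> [/(cE _ hzx)/(_ a0)/eqP|xE].
  rewrite cB subr_eq0 [X in X == _ -> _]bool_mx_scale eq_sym => /eqP.
  by apply: bool_mx_scale_inj; apply/eqP.
apply/(cE _ hzx) => a; rewrite cB.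
have [/andP[/eqP sa /eqP ta]|nb] := boolP ((src a == i) && (tgt a == j)); last exact: bool_mx0.
by rewrite (arr1 a a0) // xE; apply/eqP; rewrite subr_eq0; apply/eqP/bool_mx_scale.
Qed.

Lemma ext1_dim_simple (K : fieldType) (Q : quiver) (i j : vert Q) (L P : rep K Q)
    (u : fam L P) (p : fam P (simple_rep K i)) :
  (forall a b : arrow Q, src a = i -> tgt a = j -> src b = i -> tgt b = j -> a = b) ->
  projective P -> short_exact u p ->
  ext1_dim (simple_rep K i) (simple_rep K j) = [exists a, (src a == i) && (tgt a == j)].
Proof.
move=> arr1 projP ex; apply: xget_unique.
  by exists L, P, u, p; split=> //; exact: (ext_quot_dim_simple arr1 projP ex).
move=> d [L' [P' [u' [p' [projP' ex' hd]]]]].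
apply: has_quot_dim_uniq hd (ext_quot_dim_simple arr1 projP' ex').
exact: subspace_precomp.
Qed.

(** * Projective resolutions and Euler form of the linear quiver *)

Section Projectives.
Variables (K : fieldType) (r : nat).
Local Notation Q := (linear_quiver r).

Lemma arrow_src (a : arrow Q) : src a = (tgt a).+1 :> nat.
Proof. exact: eqP (valP a). Qed.

Definition lower_arrow (j : 'I_r) (lt_j : (j.+1 < r)%N) : arrow Q :=
  exist _ (Ordinal lt_j, j) (eqxx _).

Lemma lower_arrowE (a : arrow Q) :
  exists lt_j : ((tgt a).+1 < r)%N, a = lower_arrow lt_j.
Proof.
have lt_j : ((tgt a).+1 < r)%N by rewrite -arrow_src.
exists lt_j; apply: val_inj; rewrite /= [LHS]surjective_pairing; congr pair.
by apply: val_inj; exact: arrow_src.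
Qed.

(** For m = i + 1 this is the projective cover of the simple module at i; its
    radical is the module for m = i, so both terms of a resolution have the same
    form. *)
Definition initial_rep (m : nat) : rep K Q :=
  @Rep K Q (fun j => (j < m)%N : nat) (fun _ => const_mx 1).

Section Lift.
Variable (M : rep K Q).

(** The image of v in M_j after following k arrows down to j, starting from
    the vertex j + k.  Indexing by the end point keeps the recursion free of
    casts between the spaces M_j. *)
Fixpoint push_down (v : forall j : 'I_r, 'rV[K]_(dimv M j)) (k : nat) :
    forall j : 'I_r, 'rV[K]_(dimv M j) :=
  match k with
  | 0 => v
  | k'.+1 => fun j =>
    match pselect (j.+1 < r)%N with
    | left lt_j => push_down v k' (Ordinal lt_j) *m act M (lower_arrow lt_j)
    | right _ => 0
    end
  end.

Lemma push_down_arrow v k (a : arrow Q) :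
  push_down v k.+1 (tgt a) = push_down v k (src a) *m act M a.
Proof.
have [lt_j ->] := lower_arrowE a; rewrite /=.
case: pselect => [lt_j'|//].
by rewrite (bool_irrelevance lt_j' lt_j).
Qed.

End Lift.

(** A homomorphism from this module is determined by the image of the generator
    at i, which can be any vector there: lift that image along g and push it
    down. *)
Lemma projective_initial (i : 'I_r) : projective (initial_rep i.+1).
Proof.
move=> M N g f hg eg hf.
(* Only the value at i matters: it lifts the image of the generator. *)
pose v (j : 'I_r) := (const_mx 1 : 'M[K]_(1, (j < i.+1)%N)) *m f j *m pinvmx (g j).
have vg j : v j *m g j = const_mx 1 *m f j by apply: mulmxKpV; apply: submx_full.
have wg k (j : 'I_r) : (j + k = i)%N -> push_down v k j *m g j = const_mx 1 *m f j.
  elim: k j => [|k IH] j jk; first exact: vg.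
  have lt_j : (j.+1 < r)%N by have := ltn_ord i; lia.
  rewrite (push_down_arrow v k (lower_arrow lt_j)) -mulmxA hg mulmxA IH; last by rewrite /=; lia.
  rewrite -mulmxA -hf mulmxA mul_const_mx1 /=.
  have -> : (j.+1 < i.+1)%N by lia.
  by rewrite scale1r.
exists (fun j : 'I_r => const_mx 1 *m push_down v (i - j) j).
  move=> a; have /= sa := arrow_src a; rewrite mulmxA mul_const_mx1 -mulmxA.
  have [lt_s|ge_s] := ltnP (src a) i.+1.
    have -> : (i - tgt a)%N = (i - src a).+1 by rewrite /= in lt_s *; lia.
    rewrite push_down_arrow /=; have -> : ((sval a).2 < i.+1)%N by rewrite /= in lt_s *; lia.
    by rewrite scale1r.
  by apply: mx_no_row.
apply: famP => j; rewrite /famcomp -mulmxA.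
have [lt_j|ge_j] := ltnP j i.+1.
  rewrite wg ?subnKC // mulmxA mul_const_mx1 scale1r.
  by rewrite [const_mx 1]const_mx1_id mul1mx.
by apply: mx_no_row; rewrite /= ltnNge ge_j.
Qed.

Lemma initial_resolution (i : 'I_r) :
  exists (u : fam (initial_rep i) (initial_rep i.+1))
    (p : fam (initial_rep i.+1) (simple_rep K (i : vert Q))), short_exact u p.
Proof.
have le_cases (j : 'I_r) : (j < i.+1)%N = (j == i) || (j < i)%N by rewrite ltnS leq_eqVlt.
exists (fun j => const_mx 1), (fun j => const_mx 1).
split.
- move=> a; rewrite /= !mul_const_mx1; have /= sa := arrow_src a.
  apply/matrixP => -[x /= hx] [y /= hy]; rewrite !mxE; congr (_ %:R * _).
  move: hx; have [lt_s _|//] := ltnP (sval a).1 i.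
  by have [-> ->] : ((sval a).2 < i)%N /\ ((sval a).1 < i.+1)%N by split; rewrite /= in lt_s *; lia.
- move=> a; have /= sa := arrow_src a; rewrite /= mulmx0 mul_const_mx1; apply: bool_mx0.
  by apply/negP => /andP[lt_s /eqP/(congr1 (@nat_of_ord r)) ti]; lia.
- move=> j /=; rewrite le_cases orbC; case: (j < i)%N => /=.
    by rewrite const_mx1_1 row_free_unit unitmx1.
  by rewrite [const_mx _]flatmx0 -row_leq_rank.
- move=> j /=; rewrite le_cases; case: (eqVneq j i) => _ /=.
    by rewrite const_mx1_1 row_full_unit unitmx1.
  by rewrite -col_leq_rank.
- move=> j /=; rewrite le_cases; have [->|ji] /= := eqVneq j i.
    rewrite ltnn /= const_mx1_1 [const_mx _]flatmx0.
    have /eqP-> : kermx (1%:M : 'M[K]_1) == 0 by rewrite kermx_eq0 row_free_unit unitmx1.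
    by apply/eqmxP; rewrite !sub0mx.
  case: (j < i)%N => /=.
    have -> : const_mx 1 = 0 :> 'M[K]_(1, 0) by rewrite thinmx0.
    by rewrite const_mx1_1; apply: eqmx_sym; exact: kermx0.
  by rewrite [const_mx _]flatmx0 [kermx _]flatmx0.
Qed.

Lemma ext1_dim_linear (i j : 'I_r) :
  ext1_dim (@simple_rep K Q i) (@simple_rep K Q j) = (i == j.+1 :> nat).
Proof.
have [u [p ex]] := initial_resolution i.
have inj_arrow (a b : arrow Q) : src a = i -> tgt a = j -> src b = i -> tgt b = j -> a = b.
  case: a b => [[a1 a2] ha] [[b1 b2] hb] /= a1i a2j b1i b2j; apply: val_inj => /=.
  by rewrite a1i a2j b1i b2j.
rewrite (ext1_dim_simple (i := i : vert Q) (j := j) inj_arrow (@projective_initial i) ex).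
congr nat_of_bool; apply/existsP/eqP => [[a /andP[/eqP <- /eqP <-]]|ij].
  exact: arrow_src.
have lt_j : (j.+1 < r)%N by rewrite -ij.
exists (lower_arrow lt_j); rewrite /= eqxx andbT.
by apply/eqP/val_inj; rewrite /= ij.
Qed.

Lemma euler_form_simpler (d : 'I_r -> int) (i : 'I_r) :
  @euler_form K Q d (dimvz (@simple_rep K Q i)) =
    d i - \sum_(j < r | j == i.+1 :> nat) d j.
Proof.
rewrite /euler_form exchange_big (bigD1 i) //= [X in _ + X]big1 ?addr0; last first.
  move=> j /negPf ji; rewrite big1 // => k _; rewrite /dimvz /= ji.
  by rewrite mulr0 mul0r.
under eq_bigr => j _.
  rewrite hom_dim_simple ext1_dim_linear /dimvz /= eqxx mulr1 mulrBr.
over.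
rewrite big_split /= sumrN; congr (_ - _).
  rewrite (bigD1 i) //= eqxx mulr1 big1 ?addr0 // => j /negPf ->; exact: mulr0.
by rewrite [RHS]big_mkcond; apply: eq_bigr => j _; case: eqP; rewrite ?mulr1 ?mulr0.
Qed.

Lemma euler_form_simplel (d : 'I_r -> int) (i : 'I_r) :
  @euler_form K Q (dimvz (@simple_rep K Q i)) d =
    d i - \sum_(j < r | i == j.+1 :> nat) d j.
Proof.
rewrite /euler_form (bigD1 i) //= [X in _ + X]big1 ?addr0; last first.
  move=> j /negPf ji; rewrite big1 // => k _; rewrite /dimvz /= ji.
  by rewrite !mul0r.
under eq_bigr => j _.
  rewrite hom_dim_simple ext1_dim_linear /dimvz /= eqxx mul1r mulrBr.
over.
rewrite big_split /= sumrN; congr (_ - _).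
  rewrite (bigD1 i) //= eqxx mulr1 big1 ?addr0 // => j /negPf.
  by rewrite eq_sym => ->; exact: mulr0.
by rewrite [RHS]big_mkcond; apply: eq_bigr => j _; case: eqP; rewrite ?mulr1 ?mulr0.
Qed.

End Projectives.

(** * Structure of the serial modules *)

Section Serial.
Variables (K : fieldType) (r : nat).
Local Notation Q := (linear_quiver r).

(** Values at most 1 that decrease from i on are 1 up to some point and 0
    afterwards. *)
Lemma interval_profile (i : 'I_r) (d : 'I_r -> nat) :
  (forall j : 'I_r, (j < i)%N -> d j = 0%N) -> (d i <= 1)%N ->
  (forall j j' : 'I_r, j = j'.+1 :> nat -> j != i -> (d j <= d j')%N) ->
  exists2 k, (k <= r - i)%N & forall j : 'I_r, d j = (i <= j < i + k)%N.
Proof.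
move=> d0 d1 dS.
(* k is the distance from i to the first zero of d, or to the end. *)
pose P k := [forall j : 'I_r, (j == (i + k)%N :> nat) ==> (d j == 0%N)].
have exP : exists k, P k.
  by exists (r - i)%N; apply/forallP => j; apply/implyP => /eqP; have := ltn_ord j; lia.
case: (ex_minnP exP) => k Pk mink; exists k.
  by apply: mink; apply/forallP => j; apply/implyP => /eqP; have := ltn_ord j; lia.
have dle1 m (j : 'I_r) : (j <= i + m)%N -> (d j <= 1)%N.
  elim: m j => [|m IH] j jm.
    by have [ji|ij] := ltnP j i; [rewrite d0|have -> : j = i by apply: val_inj => /=; lia].
  have [|jm'] := leqP j (i + m); first exact: IH.
  have lt_j : (j.-1 < r)%N by have := ltn_ord j; lia.
  apply: leq_trans (dS j (Ordinal lt_j) _ _) (IH _ _); rewrite /=; try lia.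
  by apply/eqP => /(congr1 val) /=; lia.
have dk m (j : 'I_r) : j = (i + k + m)%N :> nat -> d j = 0%N.
  elim: m j => [|m IH] j jm.
    by apply/eqP; apply: (implyP (forallP Pk j)); apply/eqP; lia.
  have lt_j : (j.-1 < r)%N by have := ltn_ord j; lia.
  have ji : j != i by apply/eqP => /(congr1 val) /=; lia.
  have jS : j = (Ordinal lt_j).+1 :> nat by rewrite /=; lia.
  apply/eqP; rewrite -leqn0; apply: leq_trans (dS j _ jS ji) _.
  by rewrite IH //=; lia.
move=> j; have [ji|ij] := ltnP j i; first by rewrite d0.
have [jk|kj] := ltnP j (i + k); last by rewrite (dk (j - (i + k))%N) //; lia.
have dj1 : (d j <= 1)%N by apply: (dle1 (j - i)%N); lia.
suff : d j != 0%N by lia.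
apply/negP => dj0; suff : (k <= j - i)%N by lia.
apply: mink; apply/forallP => j'; apply/implyP => /eqP jj'.
by have -> : j' = j by apply: val_inj => /=; lia.
Qed.

Lemma dirac_family (M : rep K Q) (j : vert Q) (w : 'rV[K]_(dimv M j)) :
  exists v : forall k, 'rV[K]_(dimv M k), v j = w /\ forall k, k != j -> v k = 0.
Proof.
exists (fun k => match pselect (j = k) with
                 | left e => eq_rect j (fun k => 'rV[K]_(dimv M k)) w k e
                 | right _ => 0 end); split.
  by case: pselect => // e; rewrite (eq_axiomK e).
by move=> k kj; case: pselect => // e; rewrite e eqxx in kj.
Qed.

Lemma src_inj (a b : arrow Q) : src a = src b -> a = b.
Proof.
have := arrow_src a; have := arrow_src b.
case: a b => [[a1 a2] ha] [[b1 b2] hb] /= eb ea e; apply: val_inj => /=.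
by rewrite -e; congr pair; apply: val_inj; move: ea; rewrite e eb => -[].
Qed.

Variables (M : rep K Q) (i : 'I_r).

(** Quantifying over the families v with v_j = w expresses that the arrows
    leaving j kill w, without a cast from M_j to the source of an arrow. *)
Definition killed (j : vert Q) (w : 'rV[K]_(dimv M j)) : Prop :=
  forall v : forall k, 'rV[K]_(dimv M k), v j = w ->
    forall a, src a = j -> v (src a) *m act M a = 0.

Lemma simple_submodule (j : vert Q) (w : 'rV[K]_(dimv M j)) :
  w != 0 -> killed w ->
  exists2 V : subfam M, sub_covers (@sub0 K Q M) V & (w <= V j)%MS.
Proof.
move=> w0 wact; have [v [vj v0]] := dirac_family w.
exists (fun k => <<v k>>%MS); last by rewrite vj genmxE.
have nz k : k != j -> (<<v k>> :=: (0 : 'M[K]_(dimv M k)))%MS.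
  by move=> /v0 ->; rewrite genmx0.
split.
- by move=> a; rewrite mul0mx sub0mx.
- move=> a; have [e|ne] := eqVneq (src a) j; last first.
    by rewrite (eqmxMr _ (nz _ ne)) mul0mx sub0mx.
  by rewrite (eqmxMr _ (genmxE _)) (wact v) // sub0mx.
- by move=> k; rewrite sub0mx.
- by move=> /(_ j); rewrite vj genmxE submx0; exact/negP.
move=> W _ _ WV; have [Wj0|Wj0] := eqVneq (W j) 0.
  left=> k; have [->|kj] := eqVneq k j; first by rewrite Wj0 submx_refl.
  by rewrite -(nz k kj); exact: WV.
right=> k; have [->|kj] := eqVneq k j; last by rewrite (nz k kj) sub0mx.
have Wjw : (W j <= w)%MS by have := WV j; rewrite vj genmxE.
rewrite vj genmxE -(geq_leqif (mxrank_leqif_sup Wjw)).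
by rewrite (leq_trans (rank_leq_row w)) // lt0n mxrank_eq0.
Qed.

(** An arrow that acts injectively embeds the part of a submodule at its source
    into the part at its target.  The parts are given by generating matrices of
    any height, so that this applies to frames as well as to submodules. *)
Lemma submodule_profile (e : 'I_r -> nat) (A : forall j : 'I_r, 'M[K]_(e j, dimv M j)) :
  (forall j : 'I_r, (j < i)%N -> dimv M j = 0%N) -> (dimv M i <= 1)%N ->
  (forall a : arrow Q, src a != i -> row_free (act M a)) ->
  (forall a : arrow Q, (A (src a) *m act M a <= A (tgt a))%MS) ->
  exists2 k, (k <= r - i)%N & forall j : 'I_r, \rank (A j) = (i <= j < i + k)%N.
Proof.
move=> dim0 dim1 free subA; apply: interval_profile => [j ji||j j' jj' ji].
- by apply/eqP; rewrite -leqn0 -(dim0 _ ji) rank_leq_col.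
- exact: leq_trans (rank_leq_col _) dim1.
have lt_j : (j'.+1 < r)%N by rewrite -jj'.
have jE : j = src (lower_arrow lt_j) :> 'I_r by apply: val_inj.
have := subA (lower_arrow lt_j) => /mxrankS; rewrite jE in ji *.
by rewrite mxrankMfree ?free.
Qed.

Hypothesis socM : socle_simple M i.

(** The line of a killed vector is a simple submodule, hence contained in the
    socle, which is zero at all vertices other than i. *)
Lemma killed_socle (j : vert Q) :
  exists A : 'M[K]_(j == i, dimv M j), forall w, killed w -> (w <= A)%MS.
Proof.
have [f [_ _ [_ soc _]]] := socM; exists (f j) => w wact.
have [->|w0] := eqVneq w 0; first exact: sub0mx.
have [V covV wV] := simple_submodule w0 wact.
by apply: submx_trans wV _; have := soc _ covV j; rewrite genmxE.
Qed.

Lemma killed_off_socle (j : vert Q) (w : 'rV[K]_(dimv M j)) :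
  j != i -> killed w -> w = 0.
Proof.
move=> ji kw; have [A hA] := killed_socle j.
have A0 : A = 0 by apply: mx_no_row; rewrite (negPf ji).
have := hA w kw; rewrite A0; exact: submx0null.
Qed.

Lemma act_free_off_socle (a : arrow Q) : src a != i -> row_free (act M a).
Proof.
move=> ai; rewrite -kermx_eq0; apply/eqP/row_matrixP => x; rewrite row0.
apply: killed_off_socle => // v va b /src_inj->; rewrite va.
by apply/sub_kermxP; exact: row_sub.
Qed.

Lemma dimv_below_socle (j : 'I_r) : (j < i)%N -> dimv M j = 0%N.
Proof.
have [m] := ubnP (j : nat); elim: m j => // m IH j jm ji.
have jNi : j != i by apply/eqP => e; rewrite e ltnn in ji.
rewrite -[LHS](mxrank1 K); apply/eqP; rewrite mxrank_eq0; apply/eqP/row_matrixP => x.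
rewrite row0; apply: killed_off_socle => // v _ a aj.
have e := arrow_src a; rewrite aj in e.
have t0 : dimv M (tgt a) = 0%N by apply: IH; lia.
exact: mx_no_col.
Qed.

Lemma dimv_socle : dimv M i = 1%N.
Proof.
apply/eqP; rewrite eqn_leq; apply/andP; split.
  have [A hA] := killed_socle i.
  suff /mxrankS : (1%:M <= A)%MS.
    by rewrite mxrank1 => /leq_trans; apply; rewrite (leq_trans (rank_leq_row _)) ?leq_b1.
  apply/row_subP => x; apply: hA => v _ a ai; have e := arrow_src a; rewrite ai in e.
  have t0 : dimv M (tgt a) = 0%N by apply: dimv_below_socle; lia.
  exact: mx_no_col.
have [f [_ mf _]] := socM.
by have := mf i; rewrite -row_leq_rank => /leq_trans/(_ (rank_leq_col _)); rewrite /= eqxx.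
Qed.

Lemma dimv_le1 (j : 'I_r) : (dimv M j <= 1)%N.
Proof.
have [|||a|k _ rk] := @submodule_profile _ (fun j => 1%:M : 'M[K]_(dimv M j)).
- exact: dimv_below_socle.
- by rewrite dimv_socle.
- exact: act_free_off_socle.
- exact: submx1.
by rewrite -[X in (X <= _)%N](mxrank1 K) rk leq_b1.
Qed.

Lemma truncation_submod (k : nat) :
  submod (fun j : vert Q => if (j < k)%N then 1%:M else 0 : 'M[K]_(dimv M j)).
Proof.
move=> a; have e := arrow_src a; case: ifP => [sk|_]; last by rewrite mul0mx sub0mx.
have -> : (tgt a < k)%N by lia.
exact: submx1.
Qed.

(** If the interval of V were longer than that of U by two or more, then
    truncating M just above U would give a submodule strictly between them. *)
Lemma cover_profile (U V : subfam M) (l : nat) :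
  sub_covers U V ->
  (forall j, \rank (U j) = (i <= j < i + l)%N) ->
  (forall j, \rank (V j) = (i <= j < i + l.+1)%N).
Proof.
case=> sU sV UV nVU covers rU.
have [k kr rV] := submodule_profile dimv_below_socle (eq_leq dimv_socle) act_free_off_socle sV.
have rankUV j : (\rank (U j) <= \rank (V j))%N by exact/mxrankS/UV.
have lk : (l < k)%N.
  rewrite ltnNge; apply/negP => kl; apply: nVU => j.
  by rewrite -(geq_leqif (mxrank_leqif_sup (UV j))) rU rV; lia.
suff kl : (k <= l.+1)%N by have -> : l.+1 = k by lia.
rewrite leqNgt; apply/negP => lk1.
have ord_k x : (x < k)%N -> (i + x < r)%N by lia.
pose x : vert Q := Ordinal (ord_k l lk); pose y : vert Q := Ordinal (ord_k l.+1 lk1).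
have full (j : 'I_r) : (j < i + k)%N -> row_full (V j).
  move=> jk; rewrite /row_full rV jk andbT eqn_leq; apply/andP; split.
    by have := rank_leq_col (V j); rewrite rV jk andbT.
  by have [ij|ji] := leqP i j; [exact: dimv_le1|rewrite dimv_below_socle].
(* The truncation of M at length l + 1. *)
pose W : subfam M := fun j => if (j < i + l.+1)%N then 1%:M else 0.
have UW : sub_le U W.
  move=> j; rewrite /W; case: ifP => [_|jl]; first exact: submx1.
  have /eqP : \rank (U j) = 0%N by rewrite rU; lia.
  by rewrite mxrank_eq0 => /eqP->; exact: sub0mx.
have WV : sub_le W V.
  move=> j; rewrite /W; case: ifP => [jl|_]; last exact: sub0mx.
  by rewrite submx_full // full //; lia.
have [/(_ x)|/(_ y)] := covers W (truncation_submod _) UW WV.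
  rewrite /W /= ltn_add2l ltnSn => /mxrankS; rewrite mxrank1 rU.
  have := rank_leq_col (V x); rewrite rV /=; lia.
rewrite /W /= ltnn => /mxrankS; rewrite mxrank0 rV /=; lia.
Qed.

(** In a composition series each step lengthens the interval by one. *)
Lemma serial_dimv (n : nat) : has_length M n ->
  forall j : 'I_r, dimv M j = (i <= j < i + n)%N.
Proof.
case=> U [U0 Un cov].
have rU l : (l <= n)%N -> forall j, \rank (U l j) = (i <= j < i + l)%N.
  elim: l => [_ j|l IH ln]; last by apply: cover_profile (cov l ln) _; apply: IH; exact: ltnW.
  by rewrite U0 mxrank0; lia.
by move=> j; rewrite -rU // Un mxrank1.
Qed.

End Serial.

(** The common shape of the serial and of the simple modules, and all that their
    cluster characters depend on. *)
Definition interval_rep (K : fieldType) (r : nat) (i : 'I_r) (n : nat)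
    (M : rep K (linear_quiver r)) : Prop :=
  (forall j : 'I_r, dimv M j = (i <= j < i + n)%N) /\
  (forall a : arrow (linear_quiver r), src a != i -> row_free (act M a)).

Lemma serial_interval (K : fieldType) (r : nat) (i : 'I_r) (n : nat)
    (M : rep K (linear_quiver r)) : is_serial M i n -> interval_rep i n M.
Proof.
case=> _ socM lenM; split=> [j|a]; first exact: serial_dimv.
exact: act_free_off_socle.
Qed.

Lemma simple_interval (K : fieldType) (r : nat) (i : 'I_r) :
  interval_rep i 1 (@simple_rep K (linear_quiver r) i).
Proof.
split=> [j|a ai] /=; first by rewrite -val_eqE /=; lia.
by rewrite -row_leq_rank /= (negPf ai).
Qed.

(** * Grassmannians of the serial modules *)

Section Grassmannians.
Variables (R : realType) (r : nat).
Local Notation Q := (linear_quiver r).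
Variable (i : 'I_r).

Definition interval_dim (k : nat) : {ffun vert Q -> nat} :=
  [ffun j : 'I_r => nat_of_bool (i <= j < i + k)%N].

Lemma interval_dim_inj (k l : nat) : (k <= r - i)%N -> (l <= r - i)%N ->
  interval_dim k = interval_dim l -> k = l.
Proof.
have lt x y : (y <= r - i)%N -> (x < y)%N -> interval_dim x <> interval_dim y.
  move=> yr xy; have xr : (i + x < r)%N by lia.
  by move=> /ffunP/(_ (Ordinal xr)); rewrite !ffunE /=; lia.
by move=> kr lr e; case: (ltngtP k l) => // [/(lt _ _ lr)|/(lt _ _ kr)]; rewrite e.
Qed.

Variables (n : nat) (M : rep (Cplx R) Q).
Hypothesis (nr : (n <= r - i)%N) (intM : interval_rep i n M).

Lemma frame_dim (e : {ffun vert Q -> nat}) (A : forall j, 'M[Cplx R]_(e j, dimv M j)) :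
  @frames R Q M e A -> exists2 k, (k <= n)%N & e = interval_dim k.
Proof.
case: intM => dimM free [freeA subA].
have [j ji||k kr rA] := submodule_profile (i := i) _ _ free subA.
- by rewrite dimM; lia.
- by rewrite dimM leq_b1.
have eE (j : 'I_r) : e j = (i <= j < i + k)%N by rewrite -rA (eqP (freeA j)).
exists k; last by apply/ffunP => j; rewrite ffunE eE.
rewrite leqNgt; apply/negP => nk; have xr : (i + n < r)%N by lia.
have := rank_leq_col (A (Ordinal xr)); rewrite rA dimM /=; lia.
Qed.

Lemma interval_frame (k : nat) : (k <= n)%N ->
  @frames R Q M (interval_dim k) (fun j => pid_mx (interval_dim k j)).
Proof.
case: intM => dimM _ kn; have le j : (interval_dim k j <= dimv M j)%N.
  by rewrite ffunE dimM; lia.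
split=> [j|a]; first by rewrite /row_free rank_pid_mx.
have e := arrow_src a.
have [s0|s1] := posnP (interval_dim k (src a)).
  by rewrite [pid_mx _](mx_no_row _ 0) // mul0mx sub0mx.
apply: submx_full; rewrite /row_full rank_pid_mx //.
by move: s1; rewrite !ffunE dimM; lia.
Qed.

(** All parts of M are at most one dimensional, so a part of a submodule is
    known from its dimension. *)
Lemma frames_same_span (k : nat) (A B : set_type (@frames R Q M (interval_dim k))) :
  same_span A B.
Proof.
case: intM => dimM _; apply/forallP => j.
have [freeA _] := set_mem (valP A); have [freeB _] := set_mem (valP B).
have [s0|s1] := posnP (interval_dim k j).
  by rewrite [val A j](mx_no_row _ 0) // [val B j](mx_no_row _ 0) // submx_refl.
have full (C : 'M[Cplx R]_(interval_dim k j, dimv M j)) : row_free C -> row_full C.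
  rewrite /row_free /row_full => /eqP rC; rewrite eqn_leq rank_leq_col rC.
  by move: s1; rewrite ffunE dimM; lia.
by rewrite !submx_full ?full.
Qed.

Lemma euler_char_Gr_interval (k : nat) : (k <= n)%N ->
  euler_char R (Gr M (interval_dim k)) = 1.
Proof.
move=> kn.
pose A : set_type (@frames R Q M (interval_dim k)) :=
  exist _ (fun j => pid_mx (interval_dim k j)) (mem_set (interval_frame kn)).
apply: (@euler_char_point _ _ (\pi_({eq_quot same_span_equiv_rel M (interval_dim k)}) A : Gr _ _)) => x.
have /= <- := @reprK _ {eq_quot same_span_equiv_rel M (interval_dim k)} x.
by apply/eqmodP; exact: frames_same_span.
Qed.

Lemma euler_char_Gr_other (e : {ffun vert Q -> nat}) :
  (forall k, (k <= n)%N -> e <> interval_dim k) -> euler_char R (Gr M e) = 0.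
Proof.
move=> he; apply: euler_char_empty => x.
have [k kn /(he _ kn)//] := frame_dim
  (set_mem (valP (repr (x : {eq_quot same_span_equiv_rel M e})))).
Qed.
End Grassmannians.

(** * Cluster characters of the serial modules *)

Section ClusterFormula.
Variables (F : fieldType) (r : nat) (x y : 'I_r -> F).

(** Here [xshift t] is x_(t-1), completed by 1 when t = 0 or t > r; the shift
    makes room for the index -1. *)
Definition xshift (t : nat) : F := \prod_(j < r | j.+1 == t) x j.
Definition yext (t : nat) : F := \prod_(j < r | j == t :> nat) y j.

Lemma yext_ord (j : 'I_r) : yext j = y j.
Proof. by rewrite /yext (big_pred1 j). Qed.

Lemma xshift_neq0 t : (forall j, x j != 0) -> xshift t != 0.
Proof. by move=> x0; apply/prodf_neq0. Qed.

Lemma xshiftE (t : nat) : xshift t = \prod_j x j ^ ((j.+1 == t)%N : nat)%:Z.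
Proof. by rewrite /xshift big_mkcond; apply: eq_bigr => j _; case: (_ == _). Qed.

Lemma prod_yext (i : 'I_r) (k : nat) :
  \prod_(l < k) yext (i + l) = \prod_j y j ^+ (i <= j < i + k)%N.
Proof.
elim: k => [|k IH].
  by rewrite big_ord0 big1 // => j _; rewrite [X in _ ^+ X](_ : _ = 0%N) //; lia.
rewrite big_ord_recr /= IH /yext [X in _ * X]big_mkcond -big_split; apply: eq_bigr => j _ /=.
have [->|jk] := eqVneq (j : nat) (i + k)%N.
  rewrite -[y j in X in _ * X]expr1 -exprD; congr (_ ^+ _); lia.
rewrite mulr1; congr (_ ^+ _); lia.
Qed.

(** The value of X on the serial module with socle i and length n, where k is
    the length of the submodule. *)
Definition serial_char (i n : nat) : F :=
  \sum_(k < n.+1) xshift i * xshift (i + n).+1 / (xshift (i + k) * xshift (i + k).+1)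
    * \prod_(l < k) yext (i + l).

(** The exponent of x_j is a combination of indicators of intervals shifted by
    one, in which everything but the end points i, i + k, i + n cancels. *)
Lemma cluster_char_interval (R : realType) (i : 'I_r) (n : nat)
    (M : rep (Cplx R) (linear_quiver r)) :
  (forall j, x j != 0) -> (n <= r - i)%N -> interval_rep i n M ->
  @cluster_char R (linear_quiver r) F x y M = serial_char i n.
Proof.
move=> x0 nr intM; have [dimM _] := intM.
pose s := [seq interval_dim i k | k <- iota 0 n.+1].
have uniq_s : uniq s.
  rewrite map_inj_in_uniq ?iota_uniq // => k l; rewrite !mem_iota => kn ln.
  by move=> /interval_dim_inj; apply; lia.
rewrite /cluster_char (fsbigE s) //; last first.
  move=> e _ es; rewrite (euler_char_Gr_other nr intM) ?mul0r // => k kn ek.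
  by move: es; rewrite ek => /negP; apply; apply: map_f; rewrite mem_iota; lia.
rewrite (eq_bigl xpredT); last by move=> e; rewrite in_setT.
rewrite big_map -[iota 0 n.+1]/(index_iota 0 n.+1) big_mkord.
apply: eq_bigr => k _; have kn : (k <= n)%N by have := ltn_ord k; lia.
rewrite (euler_char_Gr_interval nr intM) // mul1r big_split /=; congr (_ * _); last first.
  by rewrite prod_yext; apply: eq_bigr => j _; rewrite ffunE.
rewrite !xshiftE invfM mulrA -!prodfV -!big_split /=; apply: eq_bigr => j _.
rewrite !invr_expz -!expfzDr //; congr (_ ^ _).
rewrite euler_form_simpler euler_form_simplel !ffunE.
(* The vertex j + 1 may be absent, but then it is also beyond the interval. *)
have next : \sum_(j' < r | j' == j.+1 :> nat) ((interval_dim i k j')%:Z)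
    = ((i <= j.+1 < i + k)%N : nat)%:Z.
  have [lt_j|ge_j] := ltnP j.+1 r.
    by rewrite (big_pred1 (Ordinal lt_j)) ?ffunE.
  rewrite big1 => [|j' /eqP e]; last by have := ltn_ord j'; lia.
  by lia.
have prev : \sum_(j' < r | j == j'.+1 :> nat) (dimvz M j' - (interval_dim i k j')%:Z)
    = ((i + k < j <= i + n)%N : nat)%:Z.
  case: (posnP j) => [j0|j_gt0].
    by rewrite big1 => [|j' /eqP e]; lia.
  have lt_j : (j.-1 < r)%N by have := ltn_ord j; lia.
  rewrite (big_pred1 (Ordinal lt_j)) => [|j' /=]; last by rewrite -val_eqE /=; lia.
  by rewrite /dimvz dimM ffunE /=; lia.
rewrite next prev /dimvz dimM; lia.
Qed.

Lemma serial_char0 (i : nat) : (forall j, x j != 0) -> serial_char i 0 = 1.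
Proof.
move=> x0; rewrite /serial_char big_ord1 big_ord0 mulr1 !addn0 divff //.
by rewrite mulf_neq0 ?xshift_neq0.
Qed.

Lemma serial_char1 (i : nat) : (forall j, x j != 0) ->
  serial_char i 1 = (xshift i.+2 + xshift i * yext i) / xshift i.+1.
Proof.
move=> x0; rewrite /serial_char big_ord_recl big_ord1 big_ord0 big_ord1 !addn0 /= !addn1.
by field; rewrite !xshift_neq0.
Qed.

(** Write the character as x_(i-1) x_(i+n) U_n.  Passing from U_n to U_(n+1)
    adds a single term, so the three characters can be compared directly. *)
Lemma serial_charS (i n : nat) : (forall j, x j != 0) ->
  serial_char i n.+2 =
  serial_char (i + n.+1) 1 * serial_char i n.+1 - yext (i + n.+1) * serial_char i n.
Proof.
move=> x0; rewrite serial_char1 //.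
pose U m := \sum_(k < m.+1) (xshift (i + k) * xshift (i + k).+1)^-1 * \prod_(l < k) yext (i + l).
have cU m : serial_char i m = xshift i * xshift (i + m).+1 * U m.
  by rewrite /serial_char mulr_sumr; apply: eq_bigr => k _; rewrite !mulrA.
have US m : U m.+1 = U m + (xshift (i + m.+1) * xshift (i + m.+1).+1)^-1
     * \prod_(l < m.+1) yext (i + l) by rewrite /U big_ord_recr.
rewrite !cU (US n.+1) (US n) [\prod_(l < n.+2) _]big_ord_recr /= !addnS.
by field; rewrite !xshift_neq0.
Qed.

End ClusterFormula.

(** * Continuants *)

Section Continuant.
Variables (R : comPzRingType) (u v : nat -> R).

(** The tridiagonal determinant with diagonal v_i, ..., v_(i+m-1), entries 1
    above and u_(i+1), ..., u_(i+m-1) below it. *)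
Fixpoint continuant (m i : nat) : R :=
  match m with
  | 0 => 1
  | m'.+1 =>
    match m' with
    | 0 => v i
    | p.+1 => v (i + m')%N * continuant m' i - u (i + m')%N * continuant p i
    end
  end.

Arguments continuant : simpl never.

Lemma continuantSS (m i : nat) :
  continuant m.+2 i = v (i + m.+1)%N * continuant m.+1 i - u (i + m.+1)%N * continuant m i.
Proof. by []. Qed.

(** Expanding both continuants of the larger size along their common last
    variable turns the difference of the two products into u_(i+m+1) times the
    same difference for m - 1. *)
Lemma continuant_frieze (m i : nat) :
  continuant m.+1 i * continuant m.+1 i.+1 =
  continuant m.+2 i * continuant m i.+1 + \prod_(1 <= k < m.+2) u (i + k)%N.
Proof.
elim: m => [|m IH]; first by rewrite big_nat1 continuantSS /continuant addn1; ring.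
rewrite big_nat_recr //=.
(* Substituting the induction hypothesis for the product leaves a polynomial identity. *)
have -> : \prod_(1 <= k < m.+2) u (i + k)%N = continuant m.+1 i * continuant m.+1 i.+1
    - continuant m.+2 i * continuant m i.+1 by rewrite IH addrAC subrr add0r.
by rewrite (continuantSS m.+1 i) (continuantSS m i.+1) !addSn !addnS; ring.
Qed.

End Continuant.

Arguments continuant : simpl never.

Lemma eq_continuant (R : comPzRingType) (u v u' v' : nat -> R) (N m i : nat) :
  (i + m <= N)%N -> (forall k, (k < N)%N -> u k = u' k) ->
  (forall k, (k < N)%N -> v k = v' k) -> continuant u v m i = continuant u' v' m i.
Proof.
move=> mN eu ev; have [b] := ubnP m; elim: b m mN => // b IH [|[|m]] mN mb //.
  by apply: ev; lia.
rewrite !continuantSS !IH ?eu ?ev //; lia.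
Qed.

Lemma rmorph_continuant (R S : comPzRingType) (f : {rmorphism R -> S})
    (u v : nat -> R) (m i : nat) :
  f (continuant u v m i) = continuant (f \o u) (f \o v) m i.
Proof.
have [b] := ubnP m; elim: b m => // b IH [|[|m]] mb //; first exact: rmorph1.
by rewrite !continuantSS rmorphB !rmorphM !IH //; lia.
Qed.

Lemma continuant01 (R : comPzRingType) (m i : nat) :
  continuant (fun=> 0 : R) (fun=> 1) m i = 1.
Proof.
have [b] := ubnP m; elim: b m => // b IH [|[|m]] mb //.
by rewrite continuantSS mul0r subr0 mul1r IH //; lia.
Qed.

(** * Quantized Chebyshev polynomials and tridiagonal determinants *)

(** The division in the definition of [cheb_frac] is exact by
    [continuant_frieze], as soon as the divisor is not zero. *)
Lemma cheb_frac_continuant (F : fieldType) (q x : nat -> F) (N m i : nat) :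
  (forall p j, (j + p <= N)%N -> continuant q x p j != 0) ->
  (i + m <= N)%N -> cheb_frac q x m i = continuant q x m i.
Proof.
move=> nz; have [b] := ubnP m; elim: b m i => // b IH [|[|m]] i mb mN //.
have -> : cheb_frac q x m.+2 i = (cheb_frac q x m.+1 i * cheb_frac q x m.+1 i.+1
     - \prod_(1 <= k < m.+2) q (i + k)%N) / cheb_frac q x m i.+1 by [].
rewrite !IH ?continuant_frieze; try lia.
by rewrite addrK mulfK // nz //; lia.
Qed.

Lemma tofrac_inj (R : idomainType) : injective (@tofrac R).
Proof. by move=> a b /eqP; rewrite tofrac_eq => /eqP. Qed.

Section Chebyshev.
Variables (n : nat).

Definition ext0 (R : nmodType) (f : 'I_n -> R) (j : nat) : R := oapp f 0 (insub j).

Lemma ext0E (R : nmodType) (f : 'I_n -> R) (j : nat) (lt_j : (j < n)%N) :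
  ext0 f j = f (Ordinal lt_j).
Proof. by rewrite /ext0 insubT. Qed.

(** The variables q_j and x_(j,1), completed by 0 for j >= n as in the
    definition of [cheb_poly]. *)
Let qX : nat -> mpoly (n + n) int := ext0 (fun k => mpolyX int (mnm1 (lshift n k))).
Let xX : nat -> mpoly (n + n) int := ext0 (fun k => mpolyX int (mnm1 (rshift n k))).

Lemma mmap_ext0 (S : comNzRingType) (h : 'I_(n + n) -> S) (e : 'I_n -> 'I_(n + n)) (j : nat) :
  mmap intr h (ext0 (fun k => mpolyX int (mnm1 (e k))) j) = ext0 (fun k => h (e k)) j.
Proof.
rewrite /ext0; case: insub => [k|] /=; last exact: mmap0.
by rewrite mmapX mmap1U.
Qed.

(** At q = 0 and x = 1 every continuant is 1. *)
Lemma generic_continuant_neq0 (p i : nat) : (i + p <= n)%N -> continuant qX xX p i != 0.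
Proof.
move=> pn; apply/eqP.
pose h (k : 'I_(n + n)) : int := match fintype.split k with inl _ => 0 | inr _ => 1 end.
move/(congr1 (mmap intr h)); rewrite rmorph_continuant mmap0.
rewrite (@eq_continuant _ _ _ (fun=> 0) (fun=> 1) n) ?continuant01 //.
  by move=> k kn; rewrite /= mmap_ext0 ext0E /h (unsplitK (inl _)).
by move=> k kn; rewrite /= mmap_ext0 ext0E /h (unsplitK (inr _)).
Qed.

Lemma cheb_polyE : cheb_poly n = continuant qX xX n 0.
Proof.
rewrite /cheb_poly; set q := fun j => oapp _ 0 _; set x := fun j => oapp _ 0 _.
have qE j : q j = tofrac (qX j).
  by rewrite /q /qX /ext0; case: insub => //=; rewrite rmorph0.
have xE j : x j = tofrac (xX j).
  by rewrite /x /xX /ext0; case: insub => //=; rewrite rmorph0.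
have cE p j : continuant q x p j = tofrac (continuant qX xX p j).
  by rewrite rmorph_continuant; apply: (@eq_continuant _ _ _ _ _ (j + p)).
have frac : tofrac (continuant qX xX n 0) = cheb_frac q x n 0.
  rewrite (@cheb_frac_continuant _ _ _ n) // => p j pj.
  by rewrite cE tofrac_eq0 generic_continuant_neq0.
by apply: xget_unique => // p; rewrite -frac => /tofrac_inj.
Qed.

Lemma cheb_evalE (F : fieldType) (u v : 'I_n -> F) :
  cheb_eval u v = continuant (ext0 u) (ext0 v) n 0.
Proof.
rewrite /cheb_eval cheb_polyE rmorph_continuant; apply: (@eq_continuant _ _ _ _ _ n) => // k kn.
  by rewrite /= mmap_ext0 !ext0E (unsplitK (inl _)).
by rewrite /= mmap_ext0 !ext0E (unsplitK (inr _)).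
Qed.

End Chebyshev.

(** Expand along the first row, then the minor of the entry 1 along its first
    column. *)
Lemma det_tridiag (F : fieldType) (u v : nat -> F) (n : nat) :
  \det (tridiag (fun k : 'I_n => u k) (fun k => v k)) = continuant u v n 0.
Proof.
have [b] := ubnP n; elim: b n => // b IH [|[|n]] nb.
- by rewrite det_mx00.
- by rewrite [tridiag _ _]mx11_scalar det_scalar1 mxE eqxx.
rewrite (expand_det_row _ ord0) !big_ord_recl big1 ?addr0; last first.
  by move=> k _; rewrite !mxE mul0r.
rewrite continuantSS -!IH; try lia.
congr (_ + _).
  rewrite mxE eqxx /= subn1 /cofactor /= expr0 mul1r; congr (_ * \det _).
  apply/matrixP => k l; rewrite !mxE /= !(inj_eq lift_inj).
  by rewrite !eqSS !subSS.
rewrite mxE /= mul1r /cofactor /= expr1 mulN1r; congr (- _).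
rewrite (expand_det_col _ ord0) big_ord_recl big1 ?addr0; last first.
  by move=> k _; rewrite !mxE /= mul0r.
rewrite !mxE /= subn1 /cofactor /= expr0 mul1r; congr (_ * \det _).
have lift2 (l : 'I_n) : lift (lift ord0 ord0) (lift ord0 l) = lift ord0 (lift ord0 l) :> 'I_n.+2.
  exact: val_inj.
apply/matrixP => k l; rewrite !mxE lift2 /= !(inj_eq lift_inj).
by rewrite !eqSS !subSS.
Qed.

(** * The cluster character as a Chebyshev polynomial *)

Lemma indet_neq0 (N : nat) (k : 'I_N) : indet k != 0.
Proof. by rewrite /indet tofrac_eq0 -msupp_eq0 msuppX. Qed.

Lemma serial_char_continuant (F : fieldType) (r : nat) (x y : 'I_r -> F) (i m : nat) :
  (forall j, x j != 0) ->
  serial_char x y i m =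
  continuant (fun k => yext y (i + k)) (fun k => serial_char x y (i + k) 1) m 0.
Proof.
move=> x0; have [b] := ubnP m; elim: b m => // b IH [|[|m]] mb.
- exact: serial_char0.
- by rewrite /continuant addn0.
by rewrite serial_charS // continuantSS !IH //; lia.
Qed.

Theorem theorem3 (R : realType) (r : nat) (hr : (1 <= r)%N)
    (i : 'I_r) (n : nat) (hn1 : (1 <= n)%N) (hn : (n <= r - i)%N)
    (M : rep (Cplx R) (linear_quiver r)) (hM : is_serial M i n) :
  let X := @cluster_char R (linear_quiver r) _ (@xvar r) (@yvar r) in
  let y := fun k : 'I_n => yvar (ord_add hn k) in
  let XS := fun k : 'I_n =>
    X (@simple_rep (Cplx R) (linear_quiver r) (ord_add hn k)) in
  X M = cheb_eval y XS /\ X M = \det (tridiag y XS).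
Proof.
move=> X y XS.
have x0 (j : 'I_r) : xvar j != 0 by exact: indet_neq0.
pose u k := yext (@yvar r) (i + k); pose v k := serial_char (@xvar r) (@yvar r) (i + k) 1.
have yE : y = (fun k : 'I_n => u k).
  by apply/funext => k; rewrite /u (yext_ord _ (ord_add hn k)).
have XSE : XS = (fun k : 'I_n => v k).
  apply/funext => k; rewrite /XS /X (cluster_char_interval _ x0 _ (@simple_interval _ _ _)) //.
  by have := ltn_ord (ord_add hn k); lia.
have -> : X M = continuant u v n 0.
  by rewrite /X (cluster_char_interval _ x0 hn (serial_interval hM)) serial_char_continuant.
rewrite cheb_evalE yE XSE det_tridiag; split=> //.
by apply: (@eq_continuant _ _ _ _ _ n) => // k kn; rewrite ext0E.
Qed.
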